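(* For every non-compact, crowded, separable metrizable space $X$, $\chi_F(X)=\mathfrak{d}$.
   Context: A space is crowded if it is non-empty and has no isolated points. For a Tychonoff space $X$, $\beta X$ denotes its Čech–Stone compactification. A non-empty set $F\subset\beta X$ is a far set of $X$ if $F\cap\mathrm{cl}_{\beta X}(N)=\emptyset$ for every closed discrete subset $N$ of $X$. The character $\chi(F)$ of a closed set $F\subset\beta X$ is the minimal cardinality of a family $\mathcal{U}$ of open subsets of $\beta X$ containing $F$ such that every open set containing $F$ contains a member of $\mathcal{U}$. For a non-compact Tychonoff space $X$, $\chi_F(X)$ is the minimal cardinal $\kappa$ such that there is a closed subset $F$ of $\beta X$ that is a far set of $X$ and has $\chi(F)=\kappa$ ($\chi_F(X)=\infty$ if there are none). $\mathfrak{d}$ is the least size of a family $\mathcal{G}\subset{}^\omega\omega$ such that for every $f\in{}^\omega\omega$ there is $g\in\mathcal{G}$ with $\{n<\omega:g(n)<f(n)\}$ finite. *)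

(* Defs.v *)
From HB Require Import structures.
From mathcomp Require Import all_boot all_order all_algebra.
From mathcomp Require Import all_classical all_reals all_analysis.

Set Implicit Arguments.
Unset Strict Implicit.
Unset Printing Implicit Defensive.

Import Order.TTheory GRing.Theory Num.Theory.
Import numFieldNormedType.Exports.

Local Open Scope classical_set_scope.
Local Open Scope card_scope.
Local Open Scope ring_scope.

(* The library compares cardinals of sets only through the relations [#<=] and
   [#=], so a cardinal number is represented by a set of that cardinality and
   the minimum of the cardinalities of the members of P by a member of P of
   least cardinality.  By [least_cardP] it exists as soon as P is non-empty,
   and by [least_card_unique] any two choices are equipotent. *)
Definition least_card (T : Type) (P : set (set T)) : set T :=
  get [set A | P A /\ forall B, P B -> A #<= B].

Lemma least_card_ex (T : Type) (P : set (set T)) : P !=set0 ->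
  exists A, P A /\ forall B, P B -> A #<= B.
Proof.
move=> [A0 PA0].
(* partial injective transversals of the family P, ordered by inclusion *)
pose Q (S : set (set T -> T)) :=
  (forall c A, S c -> P A -> A (c A)) /\
  (forall c c' A B, S c -> S c' -> P A -> P B -> c A = c' A -> c B = c' B).
have [F FQ Ftot|S [[SA Sinj] Smax]] := @Zorn_bigcup (set T -> T) Q.
  split=> [c A [S FS Sc] PA|c c' A B [S FS Sc] [S' FS' Sc'] PA PB].
    by have [FA _] := FQ _ FS; exact: (FA c A).
  have [SS'|S'S] := Ftot _ _ FS FS'.
    by have [_ Finj] := FQ _ FS'; apply: (Finj c c' A B) => //; exact: SS'.
  by have [_ Finj] := FQ _ FS; apply: (Finj c c' A B) => //; exact: S'S.
have [A [PA Aonto]] : exists A, P A /\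
    forall a, A a -> exists2 c, S c & c A = a.
  apply: contrapT => noA.
  have miss A : P A -> exists a, A a /\ forall c, S c -> c A <> a.
    move=> PA; apply: contrapT => nomiss; apply: noA; exists A; split=> // a Aa.
    apply: contrapT => na; apply: nomiss; exists a; split=> // c Sc cAa.
    by apply: na; exists c.
  have [a0 _] := miss _ PA0.
  have /choice[c0 c0P] : forall A, exists a, P A ->
      A a /\ forall c, S c -> c A <> a.
    move=> A; have [/miss[a ?]|nPA] := pselect (P A); first by exists a.
    by exists a0.
  apply: (Smax (S `|` [set c0])).
    split; first by left.
    move=> /(_ c0 (or_intror erefl)) Sc0.
    by have [_ /(_ _ Sc0)] := c0P _ PA0.
  split=> [c A [Sc|->] PA|c c' A B]; first exact: (SA c A).
    by have [] := c0P _ PA.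
  move=> [Sc|->] [Sc'|->] PA PB //; first exact: (Sinj c c' A B).
    by move=> e; have [_ /(_ _ Sc)] := c0P _ PA.
  by move=> e; have [_ /(_ _ Sc')] := c0P _ PA; rewrite e.
exists A; split=> // B PB.
pose f b := if pselect (exists2 c, S c & c B = b) is left h
  then projT1 (cid2 h) A else b.
apply: card_le_trans (card_image_le f B); apply: subset_card_le => a Aa.
have [c Sc cAa] := Aonto _ Aa; exists (c B); first exact: (SA c B).
rewrite /f; case: pselect => [h|]; last by case; exists c.
by case: cid2 => c' /= Sc' e; rewrite -cAa; exact: (Sinj _ _ B).
Qed.

Lemma least_cardP (T : Type) (P : set (set T)) : P !=set0 ->
  P (least_card P) /\ forall B, P B -> least_card P #<= B.
Proof. by move=> /least_card_ex; exact: getPex. Qed.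

Lemma least_card_unique (T : Type) (P : set (set T)) (A : set T) :
  P A -> (forall B, P B -> A #<= B) -> least_card P #= A.
Proof.
move=> PA Amin; have [Pl lmin] := least_cardP (ex_intro _ _ PA).
by apply/card_eqPle; split; [exact: lmin|exact: Amin].
Qed.

Definition dominating (G : set (nat -> nat)) : Prop :=
  forall f : nat -> nat,
    exists2 g, G g & finite_set [set n | (g n < f n)%N].

Lemma dominatingT : dominating [set: nat -> nat].
Proof.
by move=> f; exists f => //; rewrite (_ : [set _ | _] = set0) //;
  apply/seteqP; split=> // n /=; rewrite ltnn.
Qed.

Definition frakd : set (nat -> nat) := least_card dominating.

Definition crowded (T : topologicalType) : Prop :=
  [set: T] !=set0 /\ isolated [set: T] = set0.

Definition separable (T : topologicalType) : Prop :=
  exists2 S : set T, countable S & dense S.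

Definition metrizable (R : realType) (T : topologicalType) : Prop :=
  exists d : T -> T -> R,
    [/\ forall x y, d x y = 0 <-> x = y,
        forall x y, d x y = d y x,
        forall x y z, d x z <= d x y + d y z &
        forall (x : T) (A : set T),
          nbhs x A <-> exists2 e : R, 0 < e & [set y | d x y < e] `<=` A].

Definition closed_discrete (T : topologicalType) (N : set T) : Prop :=
  closed N /\ N `<=` isolated N.

Lemma set_type_hausdorff (T : topologicalType) (A : set T) :
  hausdorff_space T -> hausdorff_space (set_type A).
Proof.
move=> hT x y xy; apply: val_inj; apply: hT => U V Ux Vy.
have vc := @initial_continuous A T set_val.
have [|z [Uz Vz]] := xy (set_val @^-1` U) (set_val @^-1` V) _ (vc y V Vy).
  exact: vc.
by exists (set_val z).
Qed.

Lemma set_type_compact (T : topologicalType) (A : set T) :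
  compact A -> compact [set: set_type A].
Proof.
move=> cA F FF _.
have [|p [Ap clp]] := cA (set_val @ F) (fmap_proper_filter _ FF).
  apply: (@filterS _ F _ setT); last exact: filterT.
  by move=> x _; exact: set_mem (valP x).
exists (exist _ p (mem_set Ap)); split=> // U V FU.
move=> [_ [[W oW <-] /= Wp] WV].
have FU' : fmap set_val F (set_val @` U).
  by apply: (@filterS _ F _ U) => // z Uz; exists z.
have [_ [[z Uz <-] Wz]] := clp _ W FU' (open_nbhs_nbhs (conj oW Wp)).
by exists z; split=> //; exact: WV.
Qed.

Section stone_cech.
Variables (R : realType) (X : topologicalType).

Definition unit_interval : topologicalType :=
  set_type (`[0%R, 1%R]%classic : set R).

Definition tychonoff_cube : topologicalType :=
  prod_topology (fun _ : continuousType X unit_interval => unit_interval).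

Definition cube_eval (x : X) : tychonoff_cube :=
  fun f : continuousType X unit_interval => f x.

(* For an arbitrary X this is the Cech-Stone compactification of the Tychonoff
   reflection of X; [beta_embed] is an embedding when X is Tychonoff. *)
Definition beta : topologicalType := set_type (closure (range cube_eval)).

Definition beta_embed (x : X) : beta :=
  exist _ (cube_eval x) (mem_set (subset_closure (imageT cube_eval x))).

Lemma unit_interval_compact : compact [set: unit_interval].
Proof. exact/set_type_compact/segment_compact. Qed.

Lemma unit_interval_hausdorff : hausdorff_space unit_interval.
Proof. exact/set_type_hausdorff/order_hausdorff. Qed.

Lemma beta_compact : compact [set: beta].
Proof.
apply: set_type_compact.
apply: (@subclosed_compact _ _ [set: tychonoff_cube]) => //.
  exact: closed_closure.
have -> : [set: tychonoff_cube] =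
    [set f : tychonoff_cube | forall i, [set: unit_interval] (f i)].
  by apply/seteqP; split.
apply: (@tychonoff (continuousType X unit_interval) (fun=> unit_interval)
  (fun=> setT)) => _.
exact: unit_interval_compact.
Qed.

Lemma beta_hausdorff : hausdorff_space beta.
Proof.
apply: set_type_hausdorff; apply: hausdorff_product => _.
exact: unit_interval_hausdorff.
Qed.

Lemma cube_eval_continuous : continuous cube_eval.
Proof.
move=> x; apply/cvg_sup => f U [_ [[W oW <-] Wfx] WV].
have fW := @cts_fun _ _ f x W (open_nbhs_nbhs (conj oW Wfx)).
by apply: (@filterS _ (nbhs x) _ (f @^-1` W)) => // y Wfy; exact: WV.
Qed.

Lemma beta_embed_continuous : continuous beta_embed.
Proof.
move=> x U [_ [[W oW <-] /= Wx] WV].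
have eW := @cube_eval_continuous x W (open_nbhs_nbhs (conj oW Wx)).
by apply: (@filterS _ (nbhs x) _ (cube_eval @^-1` W)) => // y Wy; exact: WV.
Qed.

Lemma beta_embed_dense : dense (range beta_embed).
Proof.
move=> U [[p pcl] Up] [W oW WU]; rewrite -WU in Up *.
have [_ [[x _ <-] Wx]] := set_mem pcl W (open_nbhs_nbhs (conj oW Up)).
by exists (beta_embed x); split=> //; exists x.
Qed.

Lemma beta_extend (f : continuousType X unit_interval) :
  exists2 g : beta -> unit_interval, continuous g & g \o beta_embed = f.
Proof.
exists (fun p => set_val p f) => //.
move=> p; apply: (@continuous_comp beta tychonoff_cube unit_interval set_val
  (fun q => q f)).
  exact: initial_continuous.
exact: (@proj_continuous (continuousType X unit_interval)
  (fun=> unit_interval) f).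
Qed.

End stone_cech.

Definition far_set (R : realType) (X : topologicalType) (F : set (beta R X))
    : Prop :=
  F !=set0 /\ forall N : set X, closed_discrete N ->
    F `&` closure (@beta_embed R X @` N) = set0.

Definition outer_base (B : topologicalType) (F : set B) (U : set (set B))
    : Prop :=
  (forall V, U V -> open V /\ F `<=` V) /\
  (forall W, open W -> F `<=` W -> exists2 V, U V & V `<=` W).

Lemma outer_baseT (B : topologicalType) (F : set B) :
  outer_base F [set V | open V /\ F `<=` V].
Proof. by split=> // W oW FW; exists W. Qed.

Definition character (B : topologicalType) (F : set B) : set (set B) :=
  least_card (outer_base F).

(* [None] is the value oo. *)
Definition far_character (R : realType) (X : topologicalType)
    : option (set (set (beta R X))) :=
  let closed_far := [set F : set (beta R X) | closed F /\ far_set F] in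
  if pselect (closed_far !=set0)
  then Some (least_card [set character F | F in closed_far]) else None.

(* Main.v *)
Require Import Defs.
From HB Require Import structures.
From mathcomp Require Import all_boot all_order all_algebra.
From mathcomp Require Import all_classical all_reals all_analysis.
From mathcomp Require Import lra.

Set Implicit Arguments.
Unset Strict Implicit.
Unset Printing Implicit Defensive.

Import Order.TTheory GRing.Theory Num.Theory.
Import numFieldNormedType.Exports.

Local Open Scope classical_set_scope.
Local Open Scope card_scope.
Local Open Scope ring_scope.

(* Lower bound: if p lies in a far set, the traces on X of the neighbourhoods of
   p form a filter without cluster point, so there is a locally bounded
   r : X -> nat which is unbounded on each of them.  For a dense sequence s_i and
   f : nat -> nat the set N_f of the s_i with i < f (r s_i) is locally finite,
   hence closed discrete; an open V containing the far set and missing N_f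
   dominates f through g_V m = some i with s_i in V and r s_i >= m.

   Upper bound: below each point of a closed discrete sequence x_n put a tree of
   bump functions phi_n(s), s a finite sequence of naturals, where the supports
   of the successors of s lie in the zero set of phi_n(s) and converge to its
   centre without reaching it, so that a closed discrete set meets only finitely
   many of them.  Van Douwen's linked systems on these trees turn every
   g : nat -> nat into a function h_g : X -> [0,1] such that finitely many h_g
   have a common zero, while on a given closed discrete set h_g = 1 as soon as g
   is large enough.  For g in a family of size d which dominates everywhere, the
   common zeros of the extensions of the h_g to beta X form a far set, and
   finite intersections of the sets [h_g < 1/n] form an outer base of it. *)

(** * Cardinal arithmetic: comparability, squares and finite words *)

(** The point [u] is a default value, so that an injection of [A] can be given as a total function
    on [T]. *)
Lemma card_le_injP (T U : Type) (u : U) (A : set T) (B : set U) :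
  A #<= B <-> exists2 f : T -> U,
    (forall a, A a -> B (f a)) &
    (forall a b, A a -> A b -> f a = f b -> a = b).
Proof.
split=> [|[f fAB finj]].
  elim/Pchoice: U => U in u B *; pose Upt := isPointed.Build U u.
  pose U' : pointedType := HB.pack U Upt.
  move=> /(@pcard_leP T U' A B)[f]; exists f => [a Aa|a b Aa Ab]; first exact: funS.
  by apply: inj; exact: mem_set.
have /subset_card_le/(card_le_trans _) : f @` A `<=` B.
  by move=> _ [a Aa <-]; exact: fAB.
apply; suff /inj_card_eq/card_eqPle[_ //] : {in A &, injective f}.
by move=> a b /set_mem Aa /set_mem Ab; exact: finj.
Qed.

(** Copies of both sets in the sum type form a family over one type, and its member of least
    cardinality decides the comparison. *)
Lemma card_le_total (T U : Type) (A : set T) (B : set U) :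
  A #<= B \/ B #<= A.
Proof.
pose A' : set (T + U) := inl @` A; pose B' : set (T + U) := inr @` B.
have AA' : A #= A' by apply/card_esym/inj_card_eq => ? ? _ _ [].
have BB' : B #= B' by apply/card_esym/inj_card_eq => ? ? _ _ [].
have [|C [[->|->] Cmin]] := @least_card_ex _ [set A'; B'].
- by exists A'; left.
- left; rewrite (card_le_eql AA') (card_le_eqr BB'); apply: Cmin; by right.
- right; rewrite (card_le_eqr AA') (card_le_eql BB'); apply: Cmin; by left.
Qed.

Section card_setX.
Variable T : Type.

Let pairing (B : set T) (f : T -> T -> T) : Prop :=
  [/\ [set: nat] #<= B, forall a b, B a -> B b -> B (f a b) &
      forall a b a' b', B a -> B b -> B a' -> B b' ->
        f a b = f a' b' -> a = a' /\ b = b'].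

(** Starting point for Zorn's lemma: the pairing of the naturals transported to a countable subset
    of [B]. *)
Let pairing_ex (B : set T) : [set: nat] #<= B -> exists2 C, C `<=` B &
  exists f, pairing C f.
Proof.
move=> natB; have [b0 Bb0] : B !=set0.
  apply/set0P/eqP => B0; move: natB; rewrite B0 card_le0 => /eqP.
  by move=> /seteqP[/(_ 0%N I)].
have [i iB iinj] := (card_le_injP b0 _ _).1 natB.
exists (range i); first by move=> _ [n _ <-]; exact: iB.
have /choice[j jP] : forall t, exists n, range i t -> i n = t.
  move=> t; have [[n _ <-]|nt] := pselect (range i t); first by exists n.
  by exists 0%N.
have ij n : j (i n) = n by apply: iinj => //; apply: jP; exists n.
exists (fun a b => i (choice.pickle (j a, j b))); split.
- by apply/(card_le_injP b0); exists i => // a b _ _; exact: iinj.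
- by move=> a b _ _; exists (choice.pickle (j a, j b)).
- move=> _ _ _ _ [a _ <-] [b _ <-] [a' _ <-] [b' _ <-]; rewrite !ij.
  by move=> /iinj => /(_ I I) /(pcan_inj choice.pickleK)[-> ->].
Qed.

(* A maximal pairing on B ⊆ A has B equipotent to A: otherwise A contains a
   copy C of B disjoint from B, and the pairs from B ∪ C which are not pairs
   from B can be sent injectively into C. *)
Lemma card_setXX_le (A : set T) : infinite_set A -> A `*` A #<= A.
Proof.
move=> /infiniteP natA.
have [C0 C0A [f0 pf0]] := pairing_ex natA.
pose Q := {p : set T * (T -> T -> T) | p.1 `<=` A /\ pairing p.1 p.2}.
pose le (p q : Q) := `[< (sval p).1 `<=` (sval q).1 /\
  forall a b, (sval p).1 a -> (sval p).1 b ->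
    (sval p).2 a b = (sval q).2 a b >].
pose q0 : Q := exist _ (C0, f0) (conj C0A pf0).
have [||F Ftot|[[B f] /= BAf] Bmax] := @ZL_preorder Q q0 le.
- by move=> p; apply/asboolP; split.
- move=> p q r /asboolP[pq pqf] /asboolP[qr qrf]; apply/asboolP.
  split; first exact: subset_trans qr.
  by move=> a b pa pb; rewrite pqf// qrf//; exact: pq.
- have [[p0 Fp0]|F0] := pselect (F !=set0); last first.
    by exists q0 => s Fs; exfalso; apply: F0; exists s.
  pose D := \bigcup_(p in F) (sval p).1.
  have Dpair a b : D a -> D b -> exists p : Q,
      [/\ F p, (sval p).1 a & (sval p).1 b].
    move=> [p Fp pa] [q Fq qb].
    have [/asboolP[pq _]|/asboolP[qp _]] := Ftot _ _ Fp Fq.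
      by exists q; split=> //; exact: pq.
    by exists p; split=> //; exact: qp.
  have Fagree p q a b : F p -> F q -> (sval p).1 a -> (sval p).1 b ->
      (sval q).1 a -> (sval q).1 b -> (sval p).2 a b = (sval q).2 a b.
    move=> Fp Fq pa pb qa qb.
    have [/asboolP[_ pq]|/asboolP[_ qp]] := Ftot _ _ Fp Fq; first exact: pq.
    by rewrite qp.
  have /choice[g' g'P] : forall ab : T * T, exists c, forall p : Q, F p ->
      (sval p).1 ab.1 -> (sval p).1 ab.2 -> (sval p).2 ab.1 ab.2 = c.
    move=> [a b] /=; have [[p [Fp pa pb]]|np] := pselect (exists p : Q,
      [/\ F p, (sval p).1 a & (sval p).1 b]).
      by exists ((sval p).2 a b) => q Fq qa qb; exact: Fagree.
    by exists a => p Fp pa pb; exfalso; apply: np; exists p.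
  pose g a b := g' (a, b).
  have gP p a b : F p -> (sval p).1 a -> (sval p).1 b ->
    (sval p).2 a b = g a b by exact: (g'P (a, b)).
  have Dg : D `<=` A /\ pairing D g.
    split; first by move=> a [p Fp pa]; exact: (svalP p).1.
    split.
    - apply: card_le_trans (subset_card_le _); last exact: bigcup_sup Fp0.
      by have [_ []] := svalP p0.
    - move=> a b Da Db; have [p [Fp pa pb]] := Dpair a b Da Db.
      rewrite -(gP p)//; exists p => //.
      by have [_ [_ h _]] := svalP p; exact: h.
    - move=> a b a' b' Da Db Da' Db'.
      have [p [Fp pa pb]] := Dpair a b Da Db.
      have [q [Fq qa qb]] := Dpair a' b' Da' Db'.
      have [/asboolP[pq _]|/asboolP[qp _]] := Ftot _ _ Fp Fq.
        rewrite -!(gP q)//; [|exact: pq|exact: pq] => e.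
        by have [_ [_ _ h]] := svalP q; apply: h => //; exact: pq.
      rewrite -!(gP p)//; [|exact: qp|exact: qp] => e.
      by have [_ [_ _ h]] := svalP p; apply: h => //; exact: qp.
  exists (exist _ (D, g) Dg) => p Fp; apply/asboolP; split=> /=.
    exact: (bigcup_sup Fp).
  by move=> a b pa pb; exact: gP.
have /= [BA [natB fB finj]] := BAf.
have [b0 Bb0] : B !=set0.
  apply/set0P/eqP => B0; move: natB; rewrite B0 card_le0 => /eqP.
  by move=> /seteqP[/(_ 0%N I)].
have [i iB iinj] := (card_le_injP b0 _ _).1 natB.
(* Different tags give disjoint copies of [B] inside [B], so a union of two sets that inject into
   [B] injects into [B]. *)
pose tag (e : nat) b := f (i e) b.
have tagB e b : B b -> B (tag e b) by move=> Bb; apply: fB => //; exact: iB.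
have tag_inj e e' b b' : B b -> B b' -> tag e b = tag e' b' -> e = e' /\ b = b'.
  move=> Bb Bb' /finj[] //; [exact: iB|exact: iB|].
  by move=> /iinj ->.
have [AB|BAB] := card_le_total (A `\` B) B.
  have [h hB hinj] := (card_le_injP b0 _ _).1 AB.
  have AleB : A #<= B.
    apply/(card_le_injP b0).
    exists (fun a => if pselect (B a) then tag 0 a else tag 1 (h a)).
      move=> a Aa; case: pselect => Ba /=; first exact: tagB.
      by apply: tagB; exact: hB.
    move=> a b Aa Ab; case: pselect => Ba; case: pselect => Bb /=.
    - by move=> /tag_inj[].
    - by move=> /tag_inj[] //; exact: hB.
    - by move=> /tag_inj[] //; exact: hB.
    - by move=> /tag_inj[]; [exact: hB|exact: hB|move=> _; exact: hinj].
  have [k kB kinj] := (card_le_injP b0 _ _).1 AleB.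
  apply/(card_le_injP b0); exists (fun ab => f (k ab.1) (k ab.2)).
    by move=> [a b] [/= Aa Ab]; apply/BA/fB; exact: kB.
  move=> [a b] [a' b'] [/= Aa Ab] [/= Aa' Ab'] /finj[]; try exact: kB.
  by move=> /kinj-> // /kinj->.
have [h hAB hinj] := (card_le_injP b0 _ _).1 BAB.
pose C := h @` B.
have /choice[h' h'P] : forall c, exists b, C c -> B b /\ h b = c.
  move=> c; have [[b Bb <-]|nc] := pselect (C c); first by exists b.
  by exists b0.
have CB c : C c -> ~ B c by move=> [b Bb <-]; have [] := hAB _ Bb.
pose k c := if pselect (B c) then tag 0 c else tag 1 (h' c).
have kB c : (B `|` C) c -> B (k c).
  rewrite /k; case: pselect => Bc /=; first by move=> _; exact: tagB.
  by case=> // /h'P[? _]; exact: tagB.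
have kinj c d : (B `|` C) c -> (B `|` C) d -> k c = k d -> c = d.
  rewrite /k; case: pselect => Bc; case: pselect => Bd /=.
  - by move=> _ _ /tag_inj[].
  - by move=> _ [//|/h'P[? _]] /tag_inj[].
  - by move=> [//|/h'P[? _]] _ /tag_inj[].
  - move=> [//|/h'P[h'c hc]] [//|/h'P[h'd hd]] /tag_inj[]// _ e.
    by rewrite -hc -hd e.
(* [k] codes the union into [B], where [f] applies; as [h] takes its values outside [B], new and old
   values never collide. *)
pose f' a b := if pselect (B a /\ B b) then f a b else h (f (k a) (k b)).
have BCf' : B `|` C `<=` A /\ pairing (B `|` C) f'.
  split; first by move=> _ [/BA//|[b Bb <-]]; case: (hAB b Bb).
  split.
  - by apply: card_le_trans natB (subset_card_le _) => b; left.
  - move=> a b Ua Ub; rewrite /f'; case: pselect => [[Ba Bb]|_] /=.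
      by left; exact: fB.
    by right; exists (f (k a) (k b)) => //; apply: fB; exact: kB.
  - have hh a b x y : B a -> B b -> (B `|` C) x -> (B `|` C) y ->
        f a b <> h (f (k x) (k y)).
      move=> Ba Bb Ux Uy e; have [] := hAB (f (k x) (k y)).
        by apply: fB; exact: kB.
      by rewrite -e => _; apply; exact: fB.
    move=> a b a' b' Ua Ub Ua' Ub'; rewrite /f'.
    case: (pselect (B a /\ B b)) => [[Ba Bb]|_] /=;
      case: (pselect (B a' /\ B b')) => [[Ba' Bb']|_] /=.
    + exact: finj.
    + by move=> /hh; case.
    + by move=> /esym /hh; case.
    + move=> /hinj e; have [|||||e1 e2] := finj (k a) (k b) (k a') (k b').
      1-4: exact: kB.
      - by apply: e; apply: fB; exact: kB.
      - by split; exact: kinj.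
have /Bmax/asboolP[/= CB' _] : le (exist _ (B, f) BAf) (exist _ (B `|` C, f') BCf').
  apply/asboolP; split=> /=; first by move=> b; left.
  by move=> a b Ba Bb; rewrite /f'; case: pselect => // -[].
by exfalso; apply: (CB (h b0)); [exists b0|apply: CB'; right; exists b0].
Qed.

End card_setX.

Lemma card_le_setX (T T' U U' : Type) (A : set T) (A' : set T') (B : set U)
    (B' : set U') : A #<= A' -> B #<= B' -> A `*` B #<= A' `*` B'.
Proof.
move=> AA' BB'; have [[[a b] [/= Aa Bb]]|AB0] := pselect (A `*` B !=set0); last first.
  suff -> : A `*` B = set0 by exact: card_ge0.
  by apply/seteqP; split=> // x ABx; apply: AB0; exists x.
have [u A'u] : A' !=set0.
  apply/set0P/eqP => A'0; move: AA'; rewrite A'0 card_le0 => /eqP A0.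
  by rewrite A0 in Aa.
have [v B'v] : B' !=set0.
  apply/set0P/eqP => A'0; move: BB'; rewrite A'0 card_le0 => /eqP A0.
  by rewrite A0 in Bb.
have [f fA finj] := (card_le_injP u _ _).1 AA'.
have [g gB ginj] := (card_le_injP v _ _).1 BB'.
apply/(card_le_injP (u, v)); exists (fun x => (f x.1, g x.2)).
  by move=> x [Ax Bx]; split; [exact: fA|exact: gB].
by move=> [x y] [x' y'] [/= ? ?] [/= ? ?] [/finj-> // /ginj->].
Qed.

(** Nested pairs ending in [a0] separate words of equal length; the length is recorded separately
    through a copy [i] of the naturals in [A]. *)
Lemma card_le_words (T : Type) (A : set T) : infinite_set A ->
  [set s : seq T | all (mem A) s] #<= A.
Proof.
move=> infA; have /infiniteP natA := infA.
have [a0 Aa0] : A !=set0.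
  by apply/set0P/eqP => A0; apply: infA; rewrite A0.
have [i iA iinj] := (card_le_injP a0 _ _).1 natA.
have [f fA finj] := (card_le_injP a0 _ _).1 (card_setXX_le infA).
pose code := fix code s := if s is x :: s' then f (x, code s') else a0.
have codeA s : all (mem A) s -> A (code s).
  by elim: s => //= x s IH /andP[/set_mem Ax /IH ?]; exact: fA.
apply/(card_le_injP a0); exists (fun s => f (i (size s), code s)).
  by move=> s sA; apply: fA; split; [exact: iA|exact: codeA].
have AAcode t : all (mem A) t -> (A `*` A) (i (size t), code t).
  by move=> tA; split; [exact: iA|exact: codeA].
move=> s s' sA s'A /(finj _ _ (AAcode _ sA) (AAcode _ s'A))[].
move=> /(iinj _ _ I I).
elim: s s' sA s'A => [|x s IH] [|y s'] //=.
move=> /andP[/set_mem Ax sA] /andP[/set_mem Ay s'A] [ss'].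
move=> /(finj (x, code s) (y, code s')) e.
by have [-> /IH->] := e (conj Ax (codeA _ sA)) (conj Ay (codeA _ s'A)).
Qed.

Lemma dominating_infinite (G : set (nat -> nat)) : dominating G -> infinite_set G.
Proof.
move=> domG /finite_seqP[s sG].
have [g Gg] := domG (fun n => (\max_(g <- s) g n).+1).
apply/infiniteP; rewrite (_ : [set n | _] = setT)//.
apply/seteqP; split=> // n _ /=; rewrite ltnS.
have gs : g \in s by rewrite sG in Gg.
exact: (leq_bigmax_seq (F := fun g : nat -> nat => g n) g gs isT).
Qed.

(** * Metric spaces: closed discrete sets and locally bounded ranks *)

Definition locally_bounded (X : topologicalType) (r : X -> nat) : Prop :=
  forall x : X, exists m, \forall y \near x, (r y <= m)%N.

Section metric_space.
Variables (R : realType) (X : topologicalType) (d : X -> X -> R).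
Hypothesis d0 : forall x y, d x y = 0 <-> x = y.
Hypothesis dC : forall x y, d x y = d y x.
Hypothesis dT : forall x y z, d x z <= d x y + d y z.
Hypothesis dnbhs : forall (x : X) (A : set X),
  nbhs x A <-> exists2 e : R, 0 < e & [set y | d x y < e] `<=` A.

Lemma dist_refl x : d x x = 0. Proof. exact/d0. Qed.

Lemma dist_ge0 x y : 0 <= d x y.
Proof. by have := dT x y x; rewrite dist_refl (dC y x); lra. Qed.

Lemma dist_gt0 x y : x <> y -> 0 < d x y.
Proof.
by move=> xy; rewrite lt_neqAle dist_ge0 andbT; apply/eqP => /esym/d0.
Qed.

Lemma nbhs_dist (x : X) (e : R) : 0 < e -> nbhs x [set y | d x y < e].
Proof. by move=> e0; apply/dnbhs; exists e. Qed.

Lemma metric_hausdorff : hausdorff_space X.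
Proof.
move=> x y xy; apply: contrapT => /dist_gt0 dxy.
have e0 : 0 < d x y / 2 by lra.
have [z [/= xz yz]] := xy _ _ (nbhs_dist x e0) (nbhs_dist y e0).
by have := dT x z y; rewrite (dC z y); lra.
Qed.

(** Finite sets are closed, so the finitely many points of [N] near [x] other than [x] can be
    removed from a neighbourhood of [x]. *)
Lemma locally_finite_closed_discrete (N : set X) :
  (forall x : X, exists2 U, nbhs x U & finite_set (U `&` N)) -> closed_discrete N.
Proof.
move=> Nfin.
have isoN (x : X) : exists2 U, nbhs x U & U `&` N `<=` [set x].
  have [U Ux UNfin] := Nfin x; pose B := (U `&` N) `\ x.
  have cB : closed B.
    have /accessible_finite_set_closed := hausdorff_accessible metric_hausdorff.
    by apply; exact: finite_setD.
  exists (U `&` ~` B).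
    apply: filterI => //; apply: open_nbhs_nbhs; split; first exact: closed_openC.
    by move=> [_ /=].
  move=> y [[Uy nBy] Ny]; apply: contrapT => yx; exact: nBy.
split=> [x clNx|x Nx].
  have [U Ux UN] := isoN x; have [y [Ny Uy]] := clNx U Ux.
  by have <- : y = x by exact: UN.
split; first exact: mem_set.
have [U Ux UN] := isoN x; exists U => //; apply/seteqP; split=> // _ ->.
by split=> //; exact: nbhs_singleton.
Qed.

Lemma closed_discrete1 (x : X) : closed_discrete [set x].
Proof.
apply: locally_finite_closed_discrete => y; exists setT; first exact: filterT.
by rewrite setTI; exact: finite_set1.
Qed.

Lemma dense_seq : [set: X] !=set0 -> separable X ->
  exists s : nat -> X, forall U, open U -> U !=set0 -> exists i, U (s i).
Proof.
move=> [x0 _] [S /countable_injP[j jinj] denseS].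
have /choice[s sP] : forall n, exists x, (exists2 y, S y & j y = n) ->
    S x /\ j x = n.
  move=> n; have [[y Sy yn]|ny] := pselect (exists2 y, S y & j y = n).
    by exists y.
  by exists x0.
exists s => U oU /denseS/(_ oU)[x [Ux Sx]]; exists (j x).
have [Sj jj] : S (s (j x)) /\ j (s (j x)) = j x by apply: sP; exists x.
by rewrite (_ : s (j x) = x)//; apply: jinj => //; exact: mem_set.
Qed.

(** Countably many balls whose complements belong to [F] cover the space, as no point is a cluster
    point. The rank of [x] is the first index of such a ball around [x], so rank at least [m] means
    avoiding the first [m] of them. *)
Lemma filter_rank (F : set_system X) : ProperFilter F ->
  separable X -> cluster F = set0 ->
  exists2 r : X -> nat, locally_bounded r & forall m, F [set x | (m <= r x)%N].
Proof.
move=> FF sepX clF.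
have [x0 _] := filter_ex (@filterT _ F _).
have [s sdense] := dense_seq (ex_intro _ x0 I) sepX.
pose b n (x : X) : Prop := if choice.unpickle n is Some (i, k) then
  d (s i) x < k.+1%:R^-1 :> R else False.
(* Unsuitable balls become empty, which keeps every complement in [F]. *)
pose B n := if pselect (F (~` b n)) then b n else set0.
have FB n : F (~` B n).
  by rewrite /B; case: pselect => //= _; rewrite setC0; exact: filterT.
have nbhsB (x : X) : exists n, nbhs x (B n).
  have : ~ cluster F x by rewrite clF.
  rewrite /cluster /= /meets => /existsNP[A /existsNP[U /not_implyP[FA]]].
  move=> /not_implyP[Ux AU0]; have [e e0 eU] := (dnbhs _ _).1 Ux.
  have e20 : 0 < e / 2 by lra.
  have [k _ /(_ k (leqnn k)) /= ke] := near_infty_natSinv_lt (PosNum e20).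
  have k0 : 0 < k.+1%:R^-1 :> R by rewrite invr_gt0.
  have [V [oV Vx] Vk] : exists2 V, open_nbhs x V &
      V `<=` [set y | d x y < k.+1%:R^-1] by have := nbhs_dist x k0; rewrite nbhsE.
  have [i Vsi] := sdense V oV (ex_intro _ x Vx).
  have xsi := Vk _ Vsi; rewrite /= in xsi.
  have bn : b (choice.pickle (i, k)) = [set y | d (s i) y < k.+1%:R^-1].
    by apply/seteqP; split=> y; rewrite /b choice.pickleK.
  exists (choice.pickle (i, k)); rewrite /B; case: pselect => [_|nF] /=.
    rewrite bn; apply/dnbhs; exists (k.+1%:R^-1 - d x (s i)); first by rewrite subr_gt0.
    by move=> y /=; rewrite ltrBrDl; apply: le_lt_trans; rewrite (dC x); exact: dT.
  exfalso; apply: nF; apply: filterS FA => y Ay; rewrite bn /= => siy.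
  apply: AU0; exists y; split=> //; apply: eU => /=.
  apply: le_lt_trans (dT x (s i) y) _.
  by rewrite (splitr e) ltrD//; exact: lt_trans ke.
have exB x : exists n, `[< B n x >].
  by have [n /nbhs_singleton Bn] := nbhsB x; exists n; exact/asboolP.
exists (fun x => ex_minn (exB x)) => [x|m].
  have [n Bn] := nbhsB x; exists n; apply: filterS Bn => y Bny.
  by case: ex_minnP => k _; apply; exact/asboolP.
have : F [set x | forall n, (n < m)%N -> ~ B n x].
  elim: m => [|m IHm]; first by apply: filterS filterT.
  apply: filterS (filterI IHm (FB m)) => x [Bx Bmx] n.
  by rewrite ltnS leq_eqVlt => /predU1P[->//|]; exact: Bx.
apply: filterS => x Bx /=; case: ex_minnP => n /asboolP Bnx _.
by rewrite leqNgt; apply/negP => nm; exact: (Bx n).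
Qed.

Lemma noncompact_rank : ~ compact [set: X] -> separable X ->
  exists r : X -> nat, locally_bounded r /\ forall m, exists x, (m <= r x)%N.
Proof.
move=> ncX sepX; move: ncX; rewrite /compact => /existsNP[F].
move=> /existsNP[FF /not_implyP[_ clF]].
have [|r rlb rF] := @filter_rank F FF sepX.
  by apply/seteqP; split=> // x clx; apply: clF; exists x.
by exists r; split=> // m; exact: filter_ex (rF m).
Qed.

(** * Bump functions and the tree of bumps *)

Lemma dist_continuous z : continuous (d z).
Proof.
move=> x; apply/cvgrPdist_lt => e e0.
apply: filterS (nbhs_dist x e0) => y /= xy.
have := dT z x y; have := dT z y x; rewrite (dC y x) => ? ?.
by rewrite ltr_norml; apply/andP; split; lra.
Qed.

(** With [p] a centre and a positive radius: 0 on the closed ball, 1 from twice the radius on. *)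
Definition bump (p : X * R) (y : X) : R :=
  Num.min 1 (Num.max 0 (d p.1 y / p.2 - 1)).

Lemma bump_ge0 p y : 0 <= bump p y.
Proof. by rewrite le_min ler01 le_max lexx. Qed.

Lemma bump_le1 p y : bump p y <= 1.
Proof. by rewrite ge_min lexx. Qed.

Lemma bump_continuous p : continuous (bump p).
Proof.
have -> : bump p = (fun=> 1) \min ((fun=> 0) \max (fun y => d p.1 y / p.2 - 1)) by [].
move=> x; apply: continuous_min; first exact: cvg_cst.
apply: continuous_max; first exact: cvg_cst.
apply: cvgB; last exact: cvg_cst.
by apply: cvgM; [exact: dist_continuous|exact: cvg_cst].
Qed.

Lemma bump_lt1 p y : 0 < p.2 -> bump p y < 1 -> d p.1 y < 2 * p.2.
Proof.
move=> p0; rewrite gt_min ltxx /= gt_max => /andP[_].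
by rewrite ltrBlDr ltr_pdivrMr// (_ : 1 + 1 = 2)//.
Qed.

Lemma bump_eq0 p y : 0 < p.2 -> d p.1 y <= p.2 -> bump p y = 0.
Proof.
move=> p0 dp; have : d p.1 y / p.2 - 1 <= 0 by rewrite subr_le0 ler_pdivrMr// mul1r.
move=> /max_idPl h; rewrite /bump (_ : Num.max _ _ = 0)//.
by apply/min_idPr; exact: ler01.
Qed.

Lemma crowded_dist z (e : R) : crowded X -> 0 < e -> exists2 y, y <> z & d z y < e.
Proof.
move=> [_ noiso] e0; apply: contrapT => nyz.
have : isolated [set: X] z; last by rewrite noiso.
split; first exact: mem_set.
exists [set y | d z y < e]; first exact: nbhs_dist.
rewrite setIT; apply/seteqP; split=> y /=.
  by move=> zy; apply: contrapT => yz; apply: nyz; exists y.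
by move=> ->; rewrite dist_refl.
Qed.

(** The word [i :: s] is the [i]-th successor of [s]. The root centres [x n] have rank at least [n]
    and the root radii tend to 0, so near any point almost all root bumps are 1. *)
Lemma bump_tree_ex : crowded X ->
  (exists r : X -> nat, locally_bounded r /\ forall m, exists x, (m <= r x)%N) ->
  exists phi : nat -> seq nat -> X -> R,
    [/\ forall n s, continuous (phi n s),
        forall n s, exists y, phi n s y = 0,
        forall n s i y, phi n (i :: s) y < 1 -> phi n s y = 0,
        forall x : X, exists m,
          \forall y \near x, forall n, (m <= n)%N -> phi n [::] y = 1 &
        forall N : set X, closed_discrete N -> forall n s,
          exists t, forall i, (t <= i)%N -> forall y, N y -> phi n (i :: s) y = 1]
    /\ forall n s y, 0 <= phi n s y <= 1.
Proof.
move=> crX [r [rlb /choice[x xr]]].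
have inv_gt0 k : 0 < k.+1%:R^-1 :> R by rewrite invr_gt0.
(* The support of a successor lies within 4 times its radius of the old centre: the first bound puts
   it in the old zero ball, the second makes the successors converge. Distance exactly twice the
   radius keeps the old centre out of the support. *)
have /choice[c cP] : forall ip : nat * (X * R), exists q : X * R, 0 < ip.2.2 ->
    [/\ 0 < q.2, q.1 <> ip.2.1, d ip.2.1 q.1 = 2 * q.2, q.2 <= ip.2.2 / 4 &
        q.2 <= ip.1.+1%:R^-1 / 4].
  move=> [i [z e]] /=; have [e0|ne0] := pselect (0 < e); last by exists (z, 0).
  have m0 : 0 < Num.min e i.+1%:R^-1 by rewrite lt_min e0 inv_gt0.
  have [|y yz zy] := @crowded_dist z (Num.min e i.+1%:R^-1 / 2) crX; first lra.
  exists (y, d z y / 2) => _ /=; split=> //.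
  - by have := dist_gt0 (fun e => yz (esym e)); lra.
  - by lra.
  - by have : Num.min e i.+1%:R^-1 <= e by [rewrite ge_min lexx]; lra.
  - have : Num.min e i.+1%:R^-1 <= i.+1%:R^-1 by rewrite ge_min lexx orbT.
    by move: zy; set w := i.+1%:R^-1; lra.
pose node n := fix node s : X * R :=
  if s is i :: s' then c (i, node s') else (x n, n.+1%:R^-1).
have node_gt0 n s : 0 < (node n s).2.
  by elim: s => [|i s IHs] /=; [exact: inv_gt0|have [] := cP (i, node n s) IHs].
exists (fun n s => bump (node n s)); split; last first.
  by move=> n s y; rewrite bump_ge0 bump_le1.
split=> [n s|n s|n s i y|y|N cdN n s].
- exact: bump_continuous.
- exists (node n s).1; apply: bump_eq0 => //.
  by rewrite dist_refl ltW.
- have [q0 _ dq qle _] := cP (i, node n s) (node_gt0 n s).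
  move=> /(bump_lt1 (node_gt0 n (i :: s))) /= lt; apply: bump_eq0 => //.
  have := dT (node n s).1 (c (i, node n s)).1 y; rewrite /= in dq qle *; lra.
- have [m /dnbhs[e e0 em]] := rlb y.
  have e40 : 0 < e / 4 by lra.
  have [k _ /= ke] := near_infty_natSinv_lt (PosNum e40).
  exists (maxn m.+1 k); apply: filterS (nbhs_dist y e40) => z /= yz n.
  rewrite geq_max => /andP[mn kn]; apply/eqP; rewrite eq_le bump_le1 leNgt.
  apply/negP => /(bump_lt1 (node_gt0 n [::])) /= xz.
  suff /em /= : d y (x n) < e by rewrite leqNgt => /negP; apply; exact: leq_trans (xr n).
  have := ke n kn; have := dT y z (x n); rewrite (dC z) => h1 h2.
  by move: xz h2; set w := n.+1%:R^-1; lra.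
(* Near the centre of the node, [N] contains at most the centre itself, and no successor's support
   contains it. *)
- have [e e0 eN] : exists2 e, 0 < e & forall y, d (node n s).1 y < e -> N y ->
      y = (node n s).1.
    set z := (node n s).1; have [Nz|nNz] := pselect (N z).
      have [_ /(_ z Nz)[_ [V /dnbhs[e e0 eV] VN]]] := cdN.
      exists e => // y /eV Vy Ny.
      by have : (V `&` N) y by []; rewrite VN.
    have : nbhs z (~` N).
      by apply: open_nbhs_nbhs; split=> //; apply: closed_openC; case: cdN.
    by move=> /dnbhs[e e0 eN]; exists e => // y /eN.
  have [k _ /= ke] := near_infty_natSinv_lt (PosNum e0).
  exists k => i ki y Ny; apply/eqP; rewrite eq_le bump_le1 leNgt.
  apply/negP => /(bump_lt1 (node_gt0 n (i :: s))) /= lt.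
  have [q0 qz dq _ qle] := cP (i, node n s) (node_gt0 n s).
  rewrite /= in qz dq qle.
  have ye : y = (node n s).1.
    apply: eN => //; have := ke i ki; have := dT (node n s).1 (c (i, node n s)).1 y.
    by move: qle; set w := i.+1%:R^-1; lra.
  by move: lt; rewrite ye dC dq ltxx.
Qed.

(** * Lower bound: an outer base of a far set yields a dominating family *)

Section lower_bound.
Variable F : set (beta R X).

Let trace (p : beta R X) : set_system X :=
  [set A | exists2 V, open V /\ V p & @beta_embed R X @^-1` V `<=` A].

Let trace_proper p : ProperFilter (trace p).
Proof.
split.
  move=> [V [oV Vp]] V0.
  have [z [Vz [x _ xE]]] := beta_embed_dense (ex_intro _ p Vp) oV.
  by apply: (V0 x); rewrite /= xE.
split.
- by exists setT => //; split=> //; exact: openT.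
- move=> A A' [V [oV Vp] VA] [V' [oV' Vp'] VA']; exists (V `&` V').
    by split=> //; exact: openI.
  by move=> x [Vx V'x]; split; [exact: VA|exact: VA'].
- by move=> A A' AA' [V Vp VA]; exists V => // x Vx; exact/AA'/VA.
Qed.

(** A cluster point would have image [p] as [beta] is Hausdorff, but a far set misses the closed
    discrete singletons. *)
Let trace_cluster p : far_set F -> F p -> cluster (trace p) = set0.
Proof.
move=> [_ farF] Fp; apply/seteqP; split=> // x clx.
have xp : beta_embed R x = p.
  apply: beta_hausdorff => U V Ux Vp.
  have := Vp; rewrite nbhsE => -[W [oW Wp] WV].
  have [||y [Wy Uy]] := clx (@beta_embed R X @^-1` W) (@beta_embed R X @^-1` U) _ _.
  - by exists W.
  - exact: beta_embed_continuous.
  - by exists (beta_embed R y); split=> //; exact: WV.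
have := farF _ (closed_discrete1 x); rewrite -subset0; apply; split; first exact: Fp.
by rewrite image_set1 xp; exact: subset_closure.
Qed.

Lemma frakd_le_outer_base (U : set (set (beta R X))) : separable X ->
  far_set F -> outer_base F U -> frakd #<= U.
Proof.
move=> sepX farF [Uout Ubase]; have [[p Fp] farN] := farF.
have [r rlb rF] := filter_rank (trace_proper p) sepX (trace_cluster farF Fp).
have [x0 _] := @filter_ex _ _ (trace_proper p) _ (rF 0%N).
have [s sdense] := dense_seq (ex_intro _ x0 I) sepX.
have gex V m : U V -> exists i, V (beta_embed R (s i)) /\ (m <= r (s i))%N.
  move=> UV; have [oV FV] := Uout _ UV; have [W [oW Wp] Wm] := rF m.
  have [||q [Vq Wq]] := sdense (@beta_embed R X @^-1` (V `&` W)) _ _.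
  - apply: open_comp; last exact: openI.
    by move=> y _; exact: beta_embed_continuous.
  - have [||z [VWz [x _ xE]]] := @beta_embed_dense R X (V `&` W).
    + by exists p; split=> //; exact: FV.
    + exact: openI.
    + by exists x; rewrite /= xE.
  - by exists q; split=> //; exact: Wm.
have /choice[g gP] : forall V, exists g : nat -> nat, U V -> forall m,
    V (beta_embed R (s (g m))) /\ (m <= r (s (g m)))%N.
  move=> V; have [UV|nUV] := pselect (U V); last by exists (fun=> 0%N).
  by have /choice[g gP] := gex V ^~ UV; exists g.
have [_ dmin] := least_cardP (ex_intro _ _ dominatingT).
apply: card_le_trans (card_image_le g U); apply: dmin => f.
(* A monotone majorant of [f]: points of rank at most [m] then contribute only indices below [f' m]
   to [N], and rank at least [m] gives a value at least [f m]. *)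
pose f' n := \max_(k < n.+1) f k.
have lef' k n : (k <= n)%N -> (f k <= f' n)%N.
  rewrite -ltnS => kn.
  exact: (@leq_bigmax_cond _ xpredT (fun k : 'I_n.+1 => f k) (Ordinal kn)).
have f'_homo : {homo f' : m n / (m <= n)%N}.
  move=> m n mn; apply/bigmax_leqP => k _; apply: lef'.
  by apply: leq_trans mn; rewrite -ltnS.
pose N := [set s i | i in [set i | (i < f' (r (s i)))%N]].
have cdN : closed_discrete N.
  apply: locally_finite_closed_discrete => x; have [m mx] := rlb x.
  exists [set y | (r y <= m)%N] => //.
  apply: (@sub_finite_set _ _ (s @` `I_(f' m))); last first.
    exact/finite_image/finite_II.
  move=> z [/= rm [i /= ir iz]]; rewrite -iz in rm *.
  exists i => //=; apply: leq_trans ir _.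
  exact: f'_homo.
have [||V UV VN] := Ubase (~` closure (@beta_embed R X @` N)) _ _.
- by apply: closed_openC; exact: closed_closure.
- by move=> q Fq clq; have := farN _ cdN; rewrite -subset0; apply; split; eassumption.
exists (g V); first by exists V.
rewrite (_ : [set n | _] = set0)//; apply/seteqP; split=> // m /=.
have [Vs mr] := gP V UV m.
apply/negP; rewrite -leqNgt.
(* Otherwise the chosen point of [V] would belong to [N]. *)
have gf' : (f' (r (s (g V m))) <= g V m)%N.
  rewrite leqNgt; apply/negP => lt; apply: (VN _ Vs); apply: subset_closure.
  by exists (s (g V m)) => //; exists (g V m).
apply: leq_trans gf'; exact: lef'.
Qed.

End lower_bound.
End metric_space.

(** * Linked systems on the tree and the functions built from them *)

Section min_tree.
Variables (R : realType) (X : topologicalType).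
Variable phi : nat -> seq nat -> X -> R.
Hypothesis phi_ge0 : forall n s y, 0 <= phi n s y.
Hypothesis phi_le1 : forall n s y, phi n s y <= 1.
Hypothesis phi_continuous : forall n s, continuous (phi n s).
Hypothesis phi_zero : forall n s, exists y, phi n s y = 0.
Hypothesis phi_child : forall n s i y, phi n (i :: s) y < 1 -> phi n s y = 0.
Hypothesis phi_root :
  forall x : X, exists m, \forall y \near x, forall n, (m <= n)%N -> phi n [::] y = 1.
Hypothesis phi_far : forall N : set X, closed_discrete N -> forall n s,
  exists t, forall i, (t <= i)%N -> forall y, N y -> phi n (i :: s) y = 1.

(* The zero set Z_d(k, s) of [level n g d k s] is determined by
   Z_{d+1}(k, s) = Z(phi (g k :: s)) ∪ ⋃_{i < g k} Z_d(g k, i :: s), which is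
   van Douwen's recipe for families of which any d members meet. *)
Fixpoint level (n : nat) (g : nat -> nat) (d k : nat) (s : seq nat) (y : X) : R :=
  if d is d'.+1 then
    Num.min (phi n (g k :: s) y)
            (\big[Num.min/1]_(i < g k) level n g d' (g k) ((i : nat) :: s) y)
  else 1.

Lemma level_ge0 n g d k s y : 0 <= level n g d k s y.
Proof.
elim: d k s => [|d IH] k s //=; rewrite le_min phi_ge0 /=.
by apply/bigmin_geP; split.
Qed.

Lemma level_le1 n g d k s y : level n g d k s y <= 1.
Proof. by case: d => [|d] //=; rewrite ge_min phi_le1. Qed.

Lemma bigmin_continuous (m : nat) (F : nat -> X -> R) :
  (forall i, continuous (F i)) ->
  continuous (fun y => \big[Num.min/1]_(i < m) F i y).
Proof.
elim: m F => [|m IHm] F Fc.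
  have -> : (fun y => \big[Num.min/1]_(i < 0) F i y) = fun=> 1.
    by apply/funext => y; rewrite big_ord0.
  by move=> x; exact: cvg_cst.
have -> : (fun y => \big[Num.min/1]_(i < m.+1) F i y) =
    F 0 \min (fun y => \big[Num.min/1]_(i < m) F i.+1 y).
  by apply/funext => y; rewrite big_ord_recl.
move=> x; apply: continuous_min; first exact: Fc.
by apply: (IHm (fun i => F i.+1)) => i; exact: Fc.
Qed.

Lemma level_continuous n g d k s : continuous (level n g d k s).
Proof.
elim: d k s => [|d IH] k s x /=; first exact: cvg_cst.
apply: continuous_min; first exact: phi_continuous.
exact: (@bigmin_continuous (g k) (fun i => level n g d (g k) (i :: s))).
Qed.

(** All bumps entering the minimum sit at proper descendants of [s], whose supports are nested in
    the zero set of [phi n s]. *)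
Lemma level_lt1 n g d k s y : level n g d k s y < 1 -> phi n s y = 0.
Proof.
elim: d k s => [|d IH] k s /=; first by rewrite ltxx.
rewrite gt_min => /orP[/phi_child//|]; rewrite ltNge => /negP big1.
apply: contrapT => phis; apply: big1; apply/bigmin_geP; split=> // i _.
rewrite leNgt; apply/negP => /IH phii; apply: phis.
by apply: (phi_child (i := i)); rewrite phii.
Qed.

(** Let [m] be the least value [g k] over the pairs in [L], and descend to [m :: s]. Pairs attaining
    [m] vanish wherever [phi n (m :: s)] does; the others have the next level at [m :: s] among
    their terms, and they are fewer, so induction applies. *)
Lemma level_common_zero n d (L : seq ((nat -> nat) * nat)) s :
  (size L <= d)%N ->
  exists y, phi n s y = 0 /\ forall p, p \in L -> level n p.1 d p.2 s y = 0.
Proof.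
elim: d L s => [|d IH] L s.
  by rewrite leqn0 size_eq0 => /eqP->; have [y ys] := phi_zero n s; exists y.
have [->|L0] := eqVneq L [::].
  by move=> _; have [y ys] := phi_zero n s; exists y.
have exm : exists m, `[< exists2 p, p \in L & p.1 p.2 = m >].
  case: L L0 => // p L _; exists (p.1 p.2); apply/asboolP; exists p => //.
  by rewrite mem_head.
have [m /asboolP[p0 p0L p0m] mmin] := ex_minnP exm.
move=> sizeL; pose L' := [seq (p.1, p.1 p.2) | p <- L & (m < p.1 p.2)%N].
have sizeL' : (size L' <= d)%N.
  rewrite size_map size_filter -ltnS; apply: leq_trans sizeL.
  rewrite -(count_predC (fun p => m < p.1 p.2)%N L) -[X in (X < _)%N]addn0 ltn_add2l.
  by rewrite -has_count; apply/hasP; exists p0 => //=; rewrite p0m ltnn.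
have [y [ys yL']] := IH L' (m :: s) sizeL'.
exists y; split; first by apply: (phi_child (i := m)); rewrite ys.
move=> p pL; have : (m <= p.1 p.2)%N by apply: mmin; apply/asboolP; exists p.
rewrite leq_eqVlt => /predU1P[mE|mlt] /=; apply/eqP; rewrite eq_le; apply/andP; split.
- by rewrite ge_min -mE ys lexx.
- exact: (level_ge0 n p.1 d.+1).
- rewrite ge_min; apply/orP; right; apply: (bigmin_inf (Ordinal mlt)) => //=.
  rewrite (_ : level _ _ _ _ _ _ = 0)//.
  have := yL' (p.1, p.1 p.2); apply; apply/mapP; exists p => //.
  by rewrite mem_filter mlt.
- exact: (level_ge0 n p.1 d.+1).
Qed.

(** Only finitely many words have length at most [j] and letters at most [k]. *)
Lemma bounded_on_words (t : seq nat -> nat) j k :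
  exists b, forall s, (size s <= j)%N -> all (leq^~ k) s -> (t s <= b)%N.
Proof.
elim: j t => [|j IHj] t; first by exists (t [::]) => -[].
have /choice[b bP] := fun i => IHj (fun s => t (i :: s)).
exists (t [::] + \sum_(i < k.+1) b i)%N => -[|i s] /=.
  by move=> _ _; exact: leq_addr.
rewrite ltnS => sj /andP[]; rewrite -ltnS => ik sk.
apply: leq_trans (bP i s sj sk) _; apply: leq_trans (leq_addl _ _).
by rewrite (bigD1 (Ordinal ik)) //=; exact: leq_addr.
Qed.

Lemma level_far (N : set X) : closed_discrete N -> exists f, forall g,
  (forall k, (f k <= g k)%N) -> forall n y, N y ->
  forall d, level n g d n [::] y = 1.
Proof.
move=> cdN.
have /choice[t tP] : forall ns : nat * seq nat, exists t, forall i, (t <= i)%N ->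
    forall y, N y -> phi ns.1 (i :: ns.2) y = 1 by move=> [n s]; exact: phi_far.
have /choice[b bP] : forall nk : nat * nat, exists b, forall s,
    (size s <= nk.2)%N -> all (leq^~ nk.2) s -> (t (nk.1, s) <= b)%N.
  by move=> [n k]; exact: bounded_on_words.
(* Above [k], and above the thresholds of all words of length and letters at most [k] in the trees
   up to [k]; the sum serves as a common bound. *)
exists (fun k => k.+1 + \sum_(n < k.+1) b (n : nat, k))%N => g fg n y Ny d.
have gk k : (k < g k)%N by apply: leq_trans (fg k); exact: leq_addr.
have gt k s : (n <= k)%N -> (size s <= k)%N -> all (leq^~ k) s -> (t (n, s) <= g k)%N.
  move=> nk sk ak; apply: leq_trans (bP (n, k) s sk ak) _.
  apply: leq_trans (fg k); apply: leq_trans (leq_addl _ _).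
  rewrite -ltnS in nk; rewrite (bigD1 (Ordinal nk)) //=; exact: leq_addr.
(* These bounds persist from [k], [s] to [g k], [i :: s] with [i < g k], because [k < g k]. *)
suff : forall k s, (n <= k)%N -> (size s <= k)%N -> all (leq^~ k) s ->
  level n g d k s y = 1 by apply.
elim: d => [|d IHd] k s nk sk ak //=.
rewrite (tP (n, s))//; last exact: gt.
apply/eqP; rewrite eq_le ge_min lexx /= le_min lexx /=.
apply/bigmin_geP; split=> // i _; rewrite IHd//=.
- by apply: leq_trans nk _; exact: ltnW.
- exact: leq_ltn_trans (gk k).
- rewrite (ltnW (ltn_ord i)) /=; apply: sub_all ak => j jk.
  by apply: leq_trans jk _; exact: ltnW.
Qed.

Lemma far_functions : exists h : (nat -> nat) -> X -> R,
  [/\ forall g y, 0 <= h g y <= 1,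
      forall g, continuous (h g),
      forall L : seq (nat -> nat), exists y, forall g, g \in L -> h g y = 0 &
      forall N, closed_discrete N -> exists f, forall g,
        (forall k, (f k <= g k)%N) -> forall y, N y -> h g y = 1].
Proof.
(* Depth [n.+1] lets any [n.+1] functions share a zero in tree [n]; starting at [k = n] means that a
   value at [k] is only tested against trees up to [k]. *)
pose l n g := level n g n.+1 n [::].
have lroot n g y : phi n [::] y = 1 -> l n g y = 1.
  move=> phi1; apply/eqP; rewrite eq_le level_le1 leNgt; apply/negP => /level_lt1.
  by rewrite phi1 => /eqP; rewrite oner_eq0.
have /choice[M MP] : forall y, exists m, forall n, (m <= n)%N -> phi n [::] y = 1.
  by move=> y; have [m /nbhs_singleton] := phi_root y; exists m.
(* This is the minimum over all [n], since the omitted terms are 1; locally one cutoff works, which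
   gives continuity. *)
pose h g y := \big[Num.min/1]_(n < M y) l n g y.
have h_le g n y : h g y <= l n g y.
  have [nM|Mn] := ltnP n (M y); first exact: (bigmin_inf (Ordinal nM)).
  by rewrite lroot ?MP//; exact: bigmin_le_id.
have h_ge g y c : c <= 1 -> (forall n, c <= l n g y) -> c <= h g y.
  by move=> c1 cl; apply/bigmin_geP; split.
exists h; split.
- move=> g y; rewrite bigmin_le_id andbT; apply: h_ge => // n; exact: level_ge0.
- move=> g x; have [m mx] := phi_root x.
  have hE y : (forall n, (m <= n)%N -> phi n [::] y = 1) ->
      h g y = \big[Num.min/1]_(n < m) l n g y.
    move=> my; apply/eqP; rewrite eq_le; apply/andP; split.
      by apply/bigmin_geP; split=> [|n _]; [exact: bigmin_le_id|exact: h_le].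
    apply: h_ge => [|n]; first exact: bigmin_le_id.
    have [nm|mn] := ltnP n m; first exact: (bigmin_inf (Ordinal nm)).
    by rewrite lroot ?my//; exact: bigmin_le_id.
  suff : h g @ x --> h g x by [].
  rewrite (hE x (nbhs_singleton mx)).
  apply: cvg_trans (@bigmin_continuous m (fun n => l n g) _ x); last first.
    by move=> n; exact: level_continuous.
  by apply: near_eq_cvg; apply: filterS mx => y /hE.
- move=> L; have [|y [_ yL]] := @level_common_zero (size L) (size L).+1
    [seq (g, size L) | g <- L] [::]; first by rewrite size_map.
  exists y => g gL; apply/eqP; rewrite eq_le h_ge//; last first.
    by move=> n; exact: level_ge0.
  rewrite andbT; apply: le_trans (h_le g (size L) y) _.
  by rewrite /l (yL (g, size L))//; exact: map_f.
- move=> N /level_far[f fP]; exists f => g fg y Ny.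
  apply/eqP; rewrite eq_le bigmin_le_id; apply: h_ge => // n.
  by rewrite /l fP.
Qed.

End min_tree.

(** * Common zero sets in a compact space and their outer bases *)

Section zero_sets.
Variables (R : realType) (B : topologicalType) (I : Type) (A : set I).
Variable phi : I -> B -> R.
Hypothesis compactB : compact [set: B].
Hypothesis phi_continuous : forall i, continuous (phi i).
Hypothesis phi_ge0 : forall i p, 0 <= phi i p.

Let word (L : seq I) : Prop := all (mem A) L.
(** The length of the word also fixes the precision, so words alone index the base; repeating a
    letter sharpens the bound. *)
Let small (L : seq I) : set B := [set p | all (fun i => phi i p < (size L).+1%:R^-1) L].

Let small_open L : open (small L).
Proof.
rewrite /small; move: (_^-1) => c; elim: L => [|i L IHL] /=.
  by rewrite (_ : [set _ | _] = setT); [exact: openT|apply/seteqP; split].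
rewrite (_ : [set _ | _] = phi i @^-1` [set x | x < c] `&`
    [set p | all (fun i => phi i p < c) L]); last first.
  by apply/seteqP; split=> p /= => [/andP[]|[-> ->]].
apply: openI => //; apply: open_comp; last exact: open_lt.
by move=> p _; exact: phi_continuous.
Qed.

Let small_cat L L' : small (L ++ L') `<=` small L `&` small L'.
Proof.
move=> p; rewrite /small /= all_cat size_cat => /andP[pL pL'].
split; [apply: sub_all pL => i|apply: sub_all pL' => i] => /lt_le_trans; apply;
  by rewrite lef_pV2 ?posrE// ler_nat ltnS ?leq_addr ?leq_addl.
Qed.

Definition zeros : set B := [set p | forall i, A i -> phi i p = 0].

(** Otherwise the sets [small L] minus [W] generate a proper filter, and by compactness it has a
    cluster point, which is a common zero outside [W]. *)
Let small_sub W : open W -> zeros `<=` W -> exists2 L, word L & small L `<=` W.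
Proof.
move=> oW zW; apply: contrapT => noL.
pose F : set_system B := [set S | exists2 L, word L & small L `\` W `<=` S].
have FF : ProperFilter F.
  split.
    move=> [L wL LW]; apply: noL; exists L => // p Lp.
    by apply: contrapT => nWp; exact: (LW p).
  split.
  - by exists [::].
  - move=> S S' [L wL LS] [L' wL' LS']; exists (L ++ L').
      by rewrite /word all_cat wL.
    move=> p [/small_cat[Lp L'p] nWp]; split; [exact: LS|exact: LS'].
  - by move=> S S' SS' [L wL LS]; exists L => // p /LS /SS'.
have [p [_ clp]] := compactB FF filterT.
have closedF S : closed S -> F S -> S p.
  by move=> clS FS; apply: clS => V Vp; have [q [Sq Vq]] := clp S V FS Vp; exists q.
have : (~` W) p by apply: closedF; [exact: open_closedC|exists [::] => // q []].
apply; apply: zW => i Ai; apply/eqP; rewrite eq_le phi_ge0 andbT.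
apply/ler_addgt0Pr => e e0; rewrite add0r.
have [k _ /(_ k (leqnn k)) /= ke] := near_infty_natSinv_lt (PosNum e0).
apply: (closedF (phi i @^-1` [set x | x <= e])).
  apply: closed_comp; last exact: closed_le.
  by move=> q _; exact: phi_continuous.
exists (nseq k.+1 i); first by rewrite /word all_nseq; apply/orP; right; exact: mem_set.
move=> q [+ _]; rewrite /small /mkset size_nseq all_nseq orFb.
move=> /ltW /le_trans; apply.
apply: le_trans (ltW ke); rewrite lef_pV2 ?posrE// ler_nat; exact: leqW.
Qed.

Lemma zeros_neq0 : (forall L : seq I, exists p, all (fun i => phi i p == 0) L) ->
  zeros !=set0.
Proof.
move=> zL; apply/set0P/eqP => z0.
have [|L _ L0] := @small_sub set0 open0; first by rewrite z0.
have [p pL] := zL L; apply: (L0 p); apply: sub_all pL => i /eqP->.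
by rewrite invr_gt0.
Qed.

Lemma zeros_closed : closed zeros.
Proof.
rewrite (_ : zeros = \bigcap_(i in A) (phi i @^-1` [set 0])).
  apply: closed_bigI => i Ai; apply: closed_comp; last exact: closed_eq.
  by move=> q _; exact: phi_continuous.
by apply/seteqP; split.
Qed.

Lemma zeros_outer_base : infinite_set A ->
  exists2 U, outer_base zeros U & U #<= A.
Proof.
move=> infA; exists [set small L | L in word]; last first.
  by apply: card_le_trans (card_image_le _ _) _; exact: card_le_words.
split; last first.
  move=> W oW /(small_sub oW)[L wL LW]; exists (small L) => //; by exists L.
move=> _ [L wL <-]; split; first exact: small_open.
move=> p zp; rewrite /small /=; move: (size L).+1 (ltn0Sn (size L)) => m m0.
move: wL; rewrite /word; elim: L => //= i L IHL /andP[/set_mem Ai /IHL ->].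
by rewrite zp// invr_gt0 ltr0n m0.
Qed.

End zero_sets.

(** * The far set of small character and the conclusion *)

Lemma beta_extend_real (R : realType) (X : topologicalType) (f : X -> R) :
  continuous f -> (forall x, 0 <= f x <= 1) ->
  exists2 g : beta R X -> R, continuous g & g \o @beta_embed R X = f.
Proof.
move=> fc f01.
have fI x : f x \in (`[0%R, 1%R]%classic : set R).
  by apply: mem_set; rewrite /= in_itv /= f01.
pose f' x : unit_interval R := exist _ (f x) (fI x).
have f'c : continuous f'.
  move=> x V [_ [[W oW <-] /= Wx] WV].
  have fW := fc x W (open_nbhs_nbhs (conj oW Wx)).
  by apply: (@filterS _ (nbhs x) _ (f @^-1` W)) => // y Wy; exact: WV.
pose F : continuousType X (unit_interval R) :=
  HB.pack f' (isContinuous.Build _ _ f' f'c).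
have [g gc gE] := beta_extend F.
exists (fun p => set_val (g p)).
  move=> p; apply: (@continuous_comp _ _ _ g set_val); first exact: gc.
  exact: initial_continuous.
by apply/funext => x; rewrite /= -[g _]/((g \o @beta_embed R X) x) gE.
Qed.

Lemma far_set_ex (R : realType) (X : topologicalType) (h : (nat -> nat) -> X -> R) :
  (forall g y, 0 <= h g y <= 1) -> (forall g, continuous (h g)) ->
  (forall L : seq (nat -> nat), exists y, forall g, g \in L -> h g y = 0) ->
  (forall N, closed_discrete N -> exists f, forall g,
     (forall k, (f k <= g k)%N) -> forall y, N y -> h g y = 1) ->
  exists F : set (beta R X), [/\ closed F, far_set F &
    exists2 U, outer_base F U & U #<= frakd].
Proof.
move=> h01 hc hL hN.
have /choice[e eP] : forall g, exists e : beta R X -> R,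
    continuous e /\ e \o @beta_embed R X = h g.
  by move=> g; have [e] := beta_extend_real (hc g) (h01 g); exists e.
have ec g : continuous (e g) by have [] := eP g.
have eE g x : e g (beta_embed R x) = h g x.
  by have [_ <-] := eP g.
(* Closed conditions pass from [h g] to its extension, by density of [X]. *)
have closed_eP g (S : set R) : closed S -> (forall x, S (h g x)) ->
    forall p, S (e g p).
  move=> clS Sh; have clS' : closed (e g @^-1` S).
    by apply: closed_comp => // q _; exact: ec.
  move=> p; apply: (clS' p) => V; rewrite nbhsE => -[W [oW Wp] WV].
  have [q [Wq [x _ xq]]] := beta_embed_dense (ex_intro _ p Wp) oW.
  by exists q; split; [rewrite /= -xq eE|exact: WV].
have e_ge0 g p : 0 <= e g p.
  apply: (closed_eP g [set x | 0 <= x]); first exact: closed_ge.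
  by move=> x /=; case/andP: (h01 g x).
(* Raising [g] to at least a constant turns domination up to finitely many places into domination
   everywhere, without enlarging the cardinality of the family. *)
pose q (gm : (nat -> nat) * nat) n := maxn (gm.1 n) gm.2.
have [domG _] := least_cardP (ex_intro _ _ dominatingT); rewrite -/frakd in domG.
have infG := dominating_infinite domG.
have GA : frakd `*` [set: nat] #<= frakd.
  apply: card_le_trans (card_setXX_le infG); apply: card_le_setX => //.
  exact/infiniteP.
have infA : infinite_set (frakd `*` [set: nat]).
  by move=> /finite_setX_or[/infG//|]; exact: infinite_nat.
pose F := zeros (frakd `*` [set: nat]) (fun i => e (q i)).
have phic i : continuous (e (q i)) by exact: ec.
have phi0 i p : 0 <= e (q i) p by exact: e_ge0.
exists F; split.
- exact: zeros_closed.
- split.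
    apply: (@zeros_neq0 R _ _ _ (fun i => e (q i)) (@beta_compact R X) phic phi0) => L.
    have [y yL] := hL [seq q i | i <- L]; exists (beta_embed R y).
    by apply/allP => i iL /=; rewrite eE yL//; exact: map_f.
  move=> N cdN; have [f fP] := hN N cdN; have [g Gg fing] := domG f.
  have [m mP] : exists m, forall n, (g n < f n)%N -> (f n <= m)%N.
    move/finite_seqP: fing => [s sE]; exists (\max_(n <- s) f n)%N => n gf.
    apply: (leq_bigmax_seq (F := f) n) => //.
    by have : [set n | (g n < f n)%N] n by []; rewrite sE.
  have q1 y : N y -> h (q (g, m)) y = 1.
    move=> Ny; apply: fP => // k; rewrite /q /= leq_max.
    by have [//|/mP->] := leqP (f k) (g k).
  apply/seteqP; split=> // p [Fp clp].
  have : [set 1] (e (q (g, m)) p).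
    have cl1 : closed (e (q (g, m)) @^-1` [set 1]).
      by apply: closed_comp => [r _|]; [exact: ec|exact: closed_eq].
    apply: cl1; apply: closure_subset clp => _ [y Ny <-] /=.
    by rewrite eE q1.
  by rewrite /= Fp// => /eqP; rewrite eq_sym oner_eq0.
- have [U UF UA] := zeros_outer_base (@beta_compact R X) phic phi0 infA.
  by exists U => //; exact: card_le_trans UA GA.
Qed.

Theorem corollary3p11 (R : realType) (X : topologicalType)
    (ncX : ~ compact [set: X]) (crX : crowded X)
    (sepX : separable X) (metX : metrizable R X) :
  exists2 K : set (set (beta R X)),
    far_character R X = Some K & K #= frakd.
Proof.
have [d [d0 dC dT dnbhs]] := metX.
have [phi [[phic phiz phichild phiroot phifar] phi01]] :=
  bump_tree_ex d0 dC dT dnbhs crX (noncompact_rank dC dT dnbhs ncX sepX).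
have [||h [h01 hc hL hN]] := far_functions _ _ phic phiz phichild phiroot phifar.
- by move=> n s y; case/andP: (phi01 n s y).
- by move=> n s y; case/andP: (phi01 n s y).
have [F [clF farF [U UF Ud]]] := far_set_ex h01 hc hL hN.
rewrite /far_character; case: pselect => [exF|[]] /=; last by exists F.
eexists; first by [].
have [F0 F0P] := exF.
have [[F' [clF' farF'] KE] Kmin] :=
  least_cardP (ex_intro _ _ (imageP (@character (beta R X)) F0P)).
have leastP (A : set (beta R X)) := least_cardP (ex_intro _ _ (outer_baseT A)).
(* The constructed [F] bounds the minimum from above; the lower bound is applied to a far set [F']
   attaining it. *)
apply/card_eqPle; split.
  apply: card_le_trans (Kmin (character F) _) _; first by exists F.
  by have [_ /(_ U UF) Fmin] := leastP F; exact: card_le_trans Ud.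
by rewrite -KE; have [+ _] := leastP F'; exact: (frakd_le_outer_base d0 dC dT dnbhs).
Qed.
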